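(* Let $n,q,t$ be positive integers, let $\boldsymbol{x}\in\mathbb{E}_{n,q,t}$ and $\boldsymbol{y}\in\mathbb{L}^{(1)}(\boldsymbol{x})$, and define $J:=\{j\in[n]\mid D_{\{j\}}(\boldsymbol{y})\in\mathbb{D}^{(1)}(\boldsymbol{x})\}$. Let $S_1$ (resp. $S_2$) be the output of Subroutine 1 (resp. Subroutine 2), described in the context, for input $\boldsymbol{x}$, $\boldsymbol{y}$ and $\mathbf{H}_{\boldsymbol{x},\boldsymbol{y}}$. Then, if $t\ge2$, $S_1$ and $S_2$ satisfy $$J=S_1\cup S_2\qquad\text{and}\qquad |S_1\cup S_2|\le 2.$$
   Context: $[b]=\{1,\dots,b\}$, $\mathbb{Z}_q=\{0,\dots,q-1\}$. For $\boldsymbol{x}\in\mathbb{Z}_q^n$ and $S\subseteq[n]$, $D_S(\boldsymbol{x})$ is the sequence obtained from $\boldsymbol{x}$ by deleting the symbols at the positions in $S$. For $s\in[n+1]$ and $\lambda\in\mathbb{Z}_q$, $I_{s,\lambda}(\boldsymbol{x})=(x_1,\dots,x_{s-1},\lambda,x_s,\dots,x_n)$. Define $\mathbb{D}^{(1)}(\boldsymbol{x})=\{D_{\{s\}}(\boldsymbol{x})\mid s\in[n]\}$ and $\mathbb{L}^{(1)}(\boldsymbol{x})=\{D_{\{s\}}(I_{s',\lambda}(\boldsymbol{x}))\mid s,s'\in[n+1],\lambda\in\mathbb{Z}_q\}\setminus\{\boldsymbol{x}\}$. $\mathbb{E}_{n,q,t}$ is the set of sequences $\boldsymbol{x}\in\mathbb{Z}_q^n$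 that can uniquely detect $t$ deletion indices $S$ from $D_S(\boldsymbol{x})$, i.e. such that for $S,S'\subseteq[n]$ with $|S|=|S'|=t$, $D_S(\boldsymbol{x})=D_{S'}(\boldsymbol{x})$ implies $S=S'$. For $\boldsymbol{x}\in\mathbb{Z}_q^n,\boldsymbol{y}\in\mathbb{Z}_q^m$, $\mathbf{H}_{\boldsymbol x,\boldsymbol y}=(h_{i,j})_{0\le i\le n,0\le j\le m}$ is defined by $h_{i,0}=i$, $h_{0,j}=j$, and $h_{i,j}=\min\{h_{i,j-1}+1,\ h_{i-1,j}+1,\ h_{i-1,j-1}+2\cdot\mathbf{1}\{x_i\ne y_j\}\}$ for $i,j\ge1$, where $\mathbf{1}\{\cdot\}$ is $1$ if the condition holds and $0$ otherwise. Subroutine 1 (input $\boldsymbol x\in\mathbb{Z}_q^n,\boldsymbol y\in\mathbb{Z}_q^m,\mathbf{H}_{\boldsymbol x,\boldsymbol y}$; output $S_1\subseteq[m]$): start with $i=n$, $j=m$, $S_1=\emptyset$. While $i\ge1$ or $j\ge1$: if $i\ge1$ and $h_{i,j}=h_{i-1,j}+1$, set $i\gets i-1$; else if $i,j\ge1$ and $x_i=y_j$, set $i\gets i-1$, $j\gets j-1$; else if $j\ge1$ and $h_{i,j}=h_{i,j-1}+1$, set $S_1\gets S_1\cup\{j\}$, $j\gets j-1$. Subroutine 2 (same input; output $S_2\subseteq[m]$): start with $i=n$, $j=m$, $S_2=\emptyset$. While $i\ge1$ or $j\ge1$: if $j\ge1$ and $h_{i,j}=h_{i,j-1}+1$, set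 $S_2\gets S_2\cup\{j\}$, $j\gets j-1$; else if $i,j\ge1$ and $x_i=y_j$, set $i\gets i-1$, $j\gets j-1$; else if $i\ge1$ and $h_{i,j}=h_{i-1,j}+1$, set $i\gets i-1$. Here $m=n$ since $\boldsymbol{y}\in\mathbb{L}^{(1)}(\boldsymbol{x})$ has length $n$.
   Formalization: The formal theorem assumes t < n whenever n ≥ 3; without this the claim fails, e.g. n = t = 3, q = 2, x = (0,0,1), y = (0,0,0), where x lies trivially in E_{n,q,t} and J = {1,2,3}. *)

(* Defs.v *)
From mathcomp Require Import all_boot.
From mathcomp Require Import zify.

Set Implicit Arguments.
Unset Strict Implicit.
Unset Printing Implicit Defensive.

(* Symbols live in the ordinal type 'I_q = {0, ..., q-1}.  A position s of [n]
   is encoded by the ordinal of value s - 1 in 'I_n, so that tnth x i is the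
   symbol x_(i+1). *)

Definition del (T : Type) (n : nat) (S : {set 'I_n}) (x : n.-tuple T) : seq T :=
  [seq tnth x i | i <- enum (~: S)].

(* lam sits at position s, and the k-th symbol of x at position lift s k,
   i.e. at k if k < s and at k + 1 otherwise. *)
Definition ins (T : Type) (n : nat) (s : 'I_n.+1) (lam : T) (x : n.-tuple T) :
    n.+1.-tuple T :=
  [tuple (if unlift s i is Some k then tnth x k else lam) | i < n.+1].

Definition D1 (q n : nat) (x : n.-tuple 'I_q) : seq (seq 'I_q) :=
  [seq del [set s] x | s : 'I_n].

Definition L1 (q n : nat) (x : n.-tuple 'I_q) : {set n.-tuple 'I_q} :=
  [set y : n.-tuple 'I_q |
     [exists s : 'I_n.+1, exists s' : 'I_n.+1, exists lam : 'I_q,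
        del [set s] (ins s' lam x) == y]] :\ x.

Definition E (n q t : nat) : {set n.-tuple 'I_q} :=
  [set x : n.-tuple 'I_q |
     [forall S : {set 'I_n}, forall S' : {set 'I_n},
        [&& #|S| == t, #|S'| == t & del S x == del S' x] ==> (S == S')]].

(* Rows and columns are numbered from 0 as in the recurrence, hence the symbols
   x_i and y_j are onth x i.-1 and onth y j.-1.  Only the entries with
   i <= size x and j <= size y are meaningful. *)
Fixpoint Hmx (T : eqType) (x y : seq T) (i : nat) : nat -> nat :=
  if i is i'.+1 then
    fix row (j : nat) : nat :=
      if j is j'.+1 then
        minn (minn (row j' + 1) (Hmx x y i' j + 1))
             (Hmx x y i' j' + 2 * (onth x i' != onth y j'))
      else i
  else fun j => j.

Section Backtracking.

Variables (T : eqType) (n m : nat) (x : n.-tuple T) (y : m.-tuple T).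
Variable H : nat -> nat -> nat.

(* Values of the program variables i, j and S_1 (resp. S_2). *)
Definition state : Type := nat * nat * {set 'I_m}.

(* U together with the position whose 1-based index is j. *)
Definition add_index (j : nat) (U : {set 'I_m}) : {set 'I_m} :=
  U :|: [set k : 'I_m | k.+1 == j].

Definition can_up (i j : nat) : bool := (0 < i) && (H i j == H i.-1 j + 1).

Definition can_left (i j : nat) : bool := (0 < j) && (H i j == H i j.-1 + 1).

Definition can_diag (i j : nat) : bool :=
  [&& 0 < i, 0 < j & onth x i.-1 == onth y j.-1].

Definition step1 (st : state) : state :=
  let: (i, j, U) := st in
  if can_up i j then (i.-1, j, U)
  else if can_diag i j then (i.-1, j.-1, U)
  else if can_left i j then (i, j.-1, add_index j U)
  else st.

Definition step2 (st : state) : state :=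
  let: (i, j, U) := st in
  if can_left i j then (i, j.-1, add_index j U)
  else if can_diag i j then (i.-1, j.-1, U)
  else if can_up i j then (i.-1, j, U)
  else st.

(* The loop stops at i = j = 0, which is a fixed point of both steps; every
   effective step decreases i + j, so n + m iterations run the loop to its end
   (see run1_halts and run2_halts below). *)
Definition run1 : state := iter (n + m) step1 (n, m, set0).
Definition run2 : state := iter (n + m) step2 (n, m, set0).

Definition subroutine1 : {set 'I_m} := run1.2.
Definition subroutine2 : {set 'I_m} := run2.2.

End Backtracking.

Lemma Hmx0 (T : eqType) (x y : seq T) (j : nat) : Hmx x y 0 j = j.
Proof. by []. Qed.

Lemma HmxS0 (T : eqType) (x y : seq T) (i : nat) : Hmx x y i.+1 0 = i.+1.
Proof. by []. Qed.

Lemma HmxSS (T : eqType) (x y : seq T) (i j : nat) :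
  Hmx x y i.+1 j.+1 =
  minn (minn (Hmx x y i.+1 j + 1) (Hmx x y i j.+1 + 1))
       (Hmx x y i j + 2 * (onth x i != onth y j)).
Proof. by []. Qed.

Lemma Hmx_branch (T : eqType) (n m : nat) (x : n.-tuple T) (y : m.-tuple T)
    (i j : nat) :
  0 < i + j ->
  [|| can_up (Hmx x y) i j, can_diag x y i j | can_left (Hmx x y) i j].
Proof.
rewrite /can_up /can_left /can_diag.
case: i j => [|i] [|j] // _; rewrite ?succnK ?Hmx0 ?HmxS0.
- by lia.
- by case: i => [|i]; rewrite ?Hmx0 ?HmxS0; lia.
have hle : Hmx x y i j.+1 <= Hmx x y i j + 1.
  by case: i => [|i]; rewrite ?Hmx0 ?addn1 // HmxSS; lia.
by rewrite HmxSS; case: (onth x i == onth y j) => /=; lia.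
Qed.

Lemma iter_halts (m : nat) (f : state m -> state m) (k : nat) (st : state m) :
  (forall st', 0 < st'.1.1 + st'.1.2 ->
     (f st').1.1 + (f st').1.2 < st'.1.1 + st'.1.2) ->
  (forall st', st'.1 = (0, 0) -> (f st').1 = (0, 0)) ->
  st.1.1 + st.1.2 <= k -> (iter k f st).1 = (0, 0).
Proof.
move=> fdec f0; elim: k st => [|k IHk] st.
  by case: st => [[i j] U] /=; case: i j => [|i] [|j].
rewrite iterSr => hk; apply: IHk.
have [h|h] := posnP (st.1.1 + st.1.2); last by have := fdec _ h; lia.
by rewrite f0 //; case: st h {hk} => [[i j] U] /=; case: i j => [|i] [|j].
Qed.

Lemma run1_halts (T : eqType) (n m : nat) (x : n.-tuple T) (y : m.-tuple T) :
  (run1 x y (Hmx x y)).1 = (0, 0).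
Proof.
apply: iter_halts => // -[[i j] U] /=; last by case=> -> ->.
move=> ij; have := Hmx_branch x y ij; rewrite /can_up /can_left /can_diag.
by do 3?[case: ifP => /=]; lia.
Qed.

Lemma run2_halts (T : eqType) (n m : nat) (x : n.-tuple T) (y : m.-tuple T) :
  (run2 x y (Hmx x y)).1 = (0, 0).
Proof.
apply: iter_halts => // -[[i j] U] /=; last by case=> -> ->.
move=> ij; have := Hmx_branch x y ij; rewrite /can_up /can_left /can_diag.
by do 3?[case: ifP => /=]; lia.
Qed.

(* Main.v *)
Require Import Defs.
From mathcomp Require Import all_boot.
From mathcomp Require Import zify.

Set Implicit Arguments.
Unset Strict Implicit.
Unset Printing Implicit Defensive.

(** Since h_(n,n) = 2, each subroutine follows a path with exactly one upward
    and one leftward move, so it outputs a single index.  Subroutine 2, which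
    moves left as early as possible, outputs max J.  Subroutine 1, which moves
    up as early as possible, outputs min J; if n > 2 this needs adjacent symbols
    of x to differ.  Indeed x \in E n q t with 2 <= t < n makes any three
    consecutive symbols of x distinct, since x_a = x_b with b - a <= t would
    allow the deletion of a to be exchanged for that of b.  If p and r are the
    first and last positions where x and y differ, the same distinctness confines J to
    p - 1, p, r and r + 1 and leaves at most two of them, so J = {min J, max J}. *)

(** * Prefixes related by one deletion, or by one deletion on each side *)

Section Prefixes.
Variables (T : Type) (x y : nat -> T).

Definition agree (k : nat) : Prop := forall l, l < k -> x l = y l.

(* The prefix of length k of x is the prefix of length k + 1 of y with its
   symbol at position d deleted. *)
Definition ins_at (k d : nat) : Prop :=
  d <= k /\ forall l, l < k -> x l = y (bump d l).

(* Deleting position d from the prefix of length k of y gives the prefix of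
   length k of x with some position e deleted. *)
Definition sub_at (k d : nat) : Prop :=
  d < k /\ exists2 e, e < k &
    forall l, l < k.-1 -> x (bump e l) = y (bump d l).

Lemma ins_atE k d :
  ins_at k d <-> [/\ d <= k, agree d & forall l, d <= l < k -> x l = y l.+1].
Proof.
split=> [[dk h]|[dk h1 h2]]; split=> // l lk.
- by rewrite h /bump; [congr y; lia | lia].
- by rewrite h /bump; [congr y; lia | lia].
have [ld|dl] := ltnP l d; rewrite /bump.
  by rewrite h1 //; congr y; lia.
by rewrite h2; [congr y; lia | lia].
Qed.

Lemma ins_at_sub k d : ins_at k d -> sub_at k.+1 d.
Proof.
move=> [dk h]; split=> //; exists k => // l lk.
by rewrite -h // /bump; congr x; lia.
Qed.

Lemma ins_at_last k : ins_at k k <-> agree k.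
Proof.
rewrite ins_atE; split=> [[]//|h]; split=> // l; lia.
Qed.

Lemma ins_atS k d : ins_at k.+1 d ->
  d = k.+1 \/ ins_at k d /\ x k = y k.+1.
Proof.
rewrite !ins_atE => -[dk h1 h2].
have [->|dk'] := eqVneq d k.+1; first by left.
right; split; last by apply: h2; lia.
by split=> [|//|l lk]; [lia | apply: h2; lia].
Qed.

Lemma ins_atS_r k d : ins_at k d -> x k = y k.+1 -> ins_at k.+1 d.
Proof.
rewrite !ins_atE => -[dk h1 h2] xy; split=> [|//|l lk]; first by lia.
have [->|lk'] := eqVneq l k => //.
by apply: h2; lia.
Qed.

Lemma agreeS k : agree k.+1 <-> agree k /\ x k = y k.
Proof.
split=> [h|[h xy] l lk]; first by split=> [l lk|]; apply: h; lia.
by have [->//|lk'] := eqVneq l k; apply: h; lia.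
Qed.

Lemma sub_atS_r k d : sub_at k d -> x k = y k -> sub_at k.+1 d.
Proof.
move=> [dk [e ek h]] xy; split; first by lia.
exists e; first by lia.
move=> l lk; have [lk1|lk1] := ltnP l k.-1; first exact: h.
have -> : bump e l = k by rewrite /bump; lia.
by have -> : bump d l = k by rewrite /bump; lia.
Qed.

End Prefixes.

(** Either [e = k] is deleted from [x], or [d = k] is deleted from [y], or both last symbols survive
    and face each other. These cases match the upward, leftward and diagonal terms of the recurrence
    for [Hmx]. *)
Lemma sub_atS (T : Type) (x y : nat -> T) k d :
  sub_at x y k.+1 d ->
  [\/ ins_at x y k d, d = k /\ exists e, ins_at y x k e
    | sub_at x y k d /\ x k = y k].
Proof.
move=> [dk [e ek /= h]].
have [ek1|ek1] := ltnP e k; last first.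
  apply: Or31; split; first by lia.
  by move=> l lk; rewrite -h // /bump; congr x; lia.
have [dk1|dk1] := ltnP d k; last first.
  apply: Or32; split; first by lia.
  exists e; split; first by lia.
  by move=> l lk; rewrite h // /bump; congr y; lia.
apply: Or33; split; last first.
  have xe : bump e k.-1 = k by rewrite /bump; lia.
  have yd : bump d k.-1 = k by rewrite /bump; lia.
  by move: (h k.-1); rewrite xe yd; apply; lia.
by split=> //; exists e => // l lk; apply: h; lia.
Qed.

Lemma sub_at_del (T : Type) (x y : nat -> T) k e :
  ins_at y x k e -> sub_at x y k.+1 k.
Proof.
move=> [ek h]; split=> //; exists e => // l lk.
by rewrite -h //; congr y; rewrite /bump; lia.
Qed.

Lemma sub_at_last (T : Type) (x y : nat -> T) k :
  sub_at x y k.+1 k -> exists e, ins_at y x k e.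
Proof.
case=> _ [e ek /= h]; exists e; split=> // l lk.
by rewrite h // /bump; congr y; lia.
Qed.

(** * The entries 0, 1 and 2 of the matrix near its diagonal *)

Local Arguments Hmx : simpl never.

Section Distance.
Variables (T : eqType).
Implicit Types x y : seq T.

Lemma HmxC x y i j : Hmx x y i j = Hmx y x j i.
Proof.
elim: i j => [|i IHi] j; first by case: j.
elim: j => [|j IHj]; first by case: i {IHi}.
by rewrite !HmxSS IHj !IHi eq_sym (minnC (_ + 1)).
Qed.

Lemma Hmx_geq x y i j : j <= i + Hmx x y i j.
Proof.
elim: i j => [|i IHi] j //.
elim: j => [|j IHj] //.
have := IHi j; have := IHi j.+1.
rewrite HmxSS; lia.
Qed.

(** Every term of the recurrence preserves parity. In particular a diagonal entry is never 1. *)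
Lemma Hmx_odd x y i j : odd (Hmx x y i j) = odd (i + j).
Proof.
elim: i j => [|i IHi] j //.
elim: j => [|j IHj]; first by rewrite HmxS0 addn0.
rewrite HmxSS /minn; case: ifP => _; first case: ifP => _.
- by rewrite oddD IHj addnS addbT.
- by rewrite oddD IHi addSn addbT.
- by rewrite oddD IHi mul2n odd_double addbF addSn addnS /= negbK.
Qed.

Lemma Hmx_agree x y k : (Hmx x y k k = 0) <-> agree (onth x) (onth y) k.
Proof.
elim: k => [|k IHk]; first by split.
rewrite agreeS -IHk HmxSS.
have := Hmx_geq x y k k.+1; have := Hmx_geq y x k k.+1; rewrite (HmxC y x).
case: eqP => e; rewrite ?e /= => h1 h2; split=> [h|[h //]]; try lia.
by split=> //; lia.
Qed.

(** By induction on [k]: the term from above is at least 3, so a value 1 comes either from a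
    diagonal entry 0, which means agreement and [d = k], or from a previous value 1 and equal last
    symbols. *)
Lemma Hmx_ins x y k :
  (Hmx x y k k.+1 = 1) <-> exists d, ins_at (onth x) (onth y) k d.
Proof.
elim: k => [|k IHk].
  by split=> // _; exists 0; split.
have h1 := Hmx_geq x y k k.+1; have h2 := Hmx_geq x y k k.+2.
have h3 := Hmx_geq x y k.+1 k.+2; have h0 := Hmx_odd x y k k.+1.
split=> [h|[d hd]].
- have [/Hmx_agree/ins_at_last ?|hne] := eqVneq (Hmx x y k.+1 k.+1) 0.
    by exists k.+1.
  have e : onth x k == onth y k.+1.
    by move: h; rewrite HmxSS; case: eqP => //= _; lia.
  have [|d hd] := (IHk.1 _).
    by move: h; rewrite HmxSS e /=; lia.
  by exists d; apply: ins_atS_r => //; apply/eqP.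
case: (ins_atS hd) => [dk|[hd' e]].
  move: hd; rewrite dk => /ins_at_last/Hmx_agree h.
  by move: h3; rewrite HmxSS h; lia.
have := IHk.2 (ex_intro _ _ hd'); move: h3; rewrite HmxSS e eqxx /=; lia.
Qed.

(** The entry is nonzero and even, and each case of [sub_atS] makes one term of the minimum at most
    2. *)
Lemma Hmx_sub x y k d : ~ agree (onth x) (onth y) k ->
  sub_at (onth x) (onth y) k d -> Hmx x y k k = 2.
Proof.
elim: k => [|k IHk] neq hd; first by case: neq.
have h0 : Hmx x y k.+1 k.+1 != 0 by apply/eqP => /Hmx_agree.
have := Hmx_odd x y k.+1 k.+1; move: h0; rewrite HmxSS.
case: (sub_atS hd) => [hi|[_ hi]|[hs e]].
- have := (Hmx_ins x y k).2 (ex_intro _ _ hi); lia.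
- have := (Hmx_ins y x k).2 hi; rewrite (HmxC y x); lia.
have -> : Hmx x y k k = 2 by apply: IHk => // h; apply: neq; apply/agreeS.
rewrite e eqxx /=; lia.
Qed.

End Distance.

(** * Invariants of the loops, and the moves available in each kind of state *)

Lemma iter_invariant (A : Type) (f : A -> A) (P : A -> Prop) k a :
  (forall a', P a' -> P (f a')) -> P a -> P (iter k f a).
Proof. by move=> hP h0; elim: k => //= k; exact: hP. Qed.

Section Invariants.

Variables (T : eqType) (n : nat) (x y : n.-tuple T) (d : nat).

Local Notation X := (onth x).
Local Notation Y := (onth y).

Definition single : {set 'I_n} := [set k : 'I_n | k == d :> nat].

Variable le : rel nat.

(* The states (i, j, U) of a subroutine that will output the index d, extremal
   for le: before both moves, between an upward and a leftward move, between a
   leftward and an upward move, after both moves. *)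
Inductive on_track : state n -> Prop :=
| OnTrackFar k of k <= n & ~ agree X Y k & sub_at X Y k d &
    (forall j, sub_at X Y k j -> le d j) : on_track (k, k, set0)
| OnTrackIns k of ins_at X Y k d &
    (forall j, ins_at X Y k j -> le d j) : on_track (k, k.+1, set0)
| OnTrackDel k e of ins_at Y X k e : on_track (k.+1, k, single)
| OnTrackEq k of agree X Y k : on_track (k, k, single).

End Invariants.

Section Steps.

Variables (T : eqType) (n : nat) (x y : n.-tuple T) (d : nat).

Local Notation X := (onth x).
Local Notation Y := (onth y).

Lemma add_index_single : add_index d.+1 set0 = single n d.
Proof. by apply/setP => k; rewrite !inE /= eqSS. Qed.

Lemma can_left_diag k : ~ agree X Y k.+1 -> sub_at X Y k.+1 d ->
  can_left (Hmx x y) k.+1 k.+1 <-> exists e, ins_at Y X k e.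
Proof.
move=> neq hs; rewrite /can_left /= (Hmx_sub neq hs) -Hmx_ins HmxC; lia.
Qed.

Lemma can_up_diag k : ~ agree X Y k.+1 -> sub_at X Y k.+1 d ->
  can_up (Hmx x y) k.+1 k.+1 <-> exists e, ins_at X Y k e.
Proof.
move=> neq hs; rewrite /can_up /= (Hmx_sub neq hs) -Hmx_ins; lia.
Qed.

Lemma can_left_ins k : ins_at X Y k d ->
  can_left (Hmx x y) k k.+1 <-> agree X Y k.
Proof.
move=> h; have := (Hmx_ins x y k).2 (ex_intro _ _ h).
rewrite /can_left /= -Hmx_agree; lia.
Qed.

(** The entry is 1, while the one above it is at least 2 by [Hmx_geq]. *)
Lemma can_up_ins k : ins_at X Y k d -> can_up (Hmx x y) k k.+1 = false.
Proof.
move=> h; have := (Hmx_ins x y k).2 (ex_intro _ _ h).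
rewrite /can_up; case: k {h} => //= k; have := Hmx_geq x y k k.+2; lia.
Qed.

Lemma can_up_del k e : ins_at Y X k e ->
  can_up (Hmx x y) k.+1 k <-> agree X Y k.
Proof.
move=> h; have := (Hmx_ins y x k).2 (ex_intro _ _ h).
rewrite /can_up /= -Hmx_agree HmxC; lia.
Qed.

Lemma can_left_del k e : ins_at Y X k e -> can_left (Hmx x y) k.+1 k = false.
Proof.
move=> h; have := (Hmx_ins y x k).2 (ex_intro _ _ h).
rewrite /can_left HmxC; case: k {h} => //= k.
have := Hmx_geq y x k k.+2; rewrite (HmxC y x); lia.
Qed.

Lemma can_eq k : agree X Y k ->
  can_left (Hmx x y) k k = false /\ can_up (Hmx x y) k k = false.
Proof.
by move=> /Hmx_agree h; rewrite /can_left /can_up h; split; lia.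
Qed.

End Steps.

(** * Preservation of the invariants by each step *)

Section Subroutines.

Variables (T : eqType) (n : nat) (x y : n.-tuple T) (d : nat).

Local Notation X := (onth x).
Local Notation Y := (onth y).

Lemma can_diagE i j : can_diag x y i.+1 j.+1 = (X i == Y j).
Proof. by []. Qed.

(** If the symbol deleted from [x] is the last one, then in the shorter prefix its new last symbol
    can be deleted instead. *)
Lemma sub_at_prefix k j : sub_at X Y k.+1 j -> j < k -> sub_at X Y k j.
Proof.
move=> /sub_atS[hi|[-> _]|[]] // jk; last by rewrite ltnn in jk.
case: k hi jk => // k /ins_atS[-> |[hi _] _]; first by rewrite ltnn.
exact: ins_at_sub.
Qed.

(** Here some [e < k] is deleted from [x], so [Y k.-1 = X k = Y k]. Deleting [k.-1] from [y]
    therefore has the same effect as deleting [k]. Hence the minimum is never [k] when the last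
    symbols are equal. *)
Lemma sub_at_pred k : ~ agree X Y k.+1 -> X k = Y k -> sub_at X Y k.+1 k ->
  exists2 j, j < k & sub_at X Y k.+1 j.
Proof.
move=> neq xy /sub_atS[/ins_at_last h|[_ [e [ek h]]]|[[]]]; last by rewrite ltnn.
  by case: neq; apply/agreeS.
have ek' : e < k.
  rewrite ltn_neqAle ek andbT; apply/eqP => ek'; case: neq; apply/agreeS.
  by split=> // l lk; rewrite h // ek' /bump; congr onth; lia.
exists k.-1; first by lia.
split; first by lia.
exists e; first by lia.
move=> l /= lk; rewrite -h //; have [lk'|lk'] := ltnP l k.-1.
  by rewrite /bump; congr onth; lia.
rewrite h // (_ : bump e l = k) 1?xy; last by rewrite /bump; lia.
by rewrite /bump; congr onth; lia.
Qed.

(** When an upward move is possible, it must not lose the minimum [d]. This is where subroutine 1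
    relies on distinct adjacent symbols. *)
Lemma sub_at_up k j : (1 < k -> X k.-1 <> X k) -> ~ agree X Y k.+1 ->
  sub_at X Y k.+1 d -> (forall j', sub_at X Y k.+1 j' -> d <= j') ->
  ins_at X Y k j -> ins_at X Y k d.
Proof.
move=> adj neq hd hmin hj.
have jd := hmin _ (ins_at_sub hj).
case: (sub_atS hd) => [//|[dk _]|[[dk _] xy]].
  by suff -> : d = j by []; case: hj; lia.
have [-> //|dj] := eqVneq d j.
case/ins_atE: (hj) => jk _ hl.
have [jk'|jk'] := eqVneq j k.
  by case: neq; apply/agreeS; split=> //; apply/ins_at_last; rewrite -{2}jk'.
(* Now [d < j < k], and the shift caused by [j] gives [X k.-1 = Y k = X k]. *)
case: adj; first by lia.
by rewrite hl; [rewrite xy prednK //; lia | lia].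
Qed.

Lemma agree_le k j : agree X Y k -> j <= k -> agree X Y j.
Proof. by move=> h jk l lj; apply: h; lia. Qed.

Lemma del_diag k e : ins_at Y X k.+1 e -> ~ agree X Y k.+1 ->
  X k.+1 = Y k /\ ins_at Y X k e.
Proof.
move=> he neq; case: (ins_atS he) => [ek|[? ->] //].
by case: neq => l lk; symmetry; move: l lk; apply/ins_at_last; rewrite -{2}ek.
Qed.

Lemma step1_on_track st : (forall k, 1 < k < n -> X k.-1 <> X k) ->
  on_track x y d leq st -> on_track x y d leq (step1 x y (Hmx x y) st).
Proof.
move=> adj; case=> [k kn neq hd hmin|k hd hmin|k e he|k h]; rewrite /step1.
- case: k kn neq hd hmin => [|k] kn neq hd hmin; first by case: neq.
  case: ifP => [/(can_up_diag neq hd)[j hj]|/negP up].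
    apply: OnTrackIns => [|j' /ins_at_sub/hmin //].
    apply: sub_at_up hj => // k1; apply: adj; lia.
  rewrite can_diagE; case: eqP => [xy|xy].
    have dk : d < k.
      case: (hd) => dk _; rewrite ltn_neqAle -ltnS dk andbT; apply/eqP => dk'.
      rewrite dk' in hd; have [j jk /hmin] := sub_at_pred neq xy hd; lia.
    apply: OnTrackFar => [||//|j hj]; first by lia.
    + by move=> h; apply: neq; apply/agreeS.
    + exact: sub_at_prefix.
    + exact/hmin/sub_atS_r.
  case: (sub_atS hd) => [hi|[-> [e he]]|[_ //]].
    by case: up; apply/(can_up_diag neq hd); exists d.
  have -> : can_left (Hmx x y) k.+1 k.+1 by apply/(can_left_diag neq hd); exists e.
  rewrite add_index_single; exact: OnTrackDel he.
- rewrite (can_up_ins hd); case: k hd hmin => [|k] hd hmin.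
    rewrite (_ : can_left _ _ _ = true); last by apply/(can_left_ins hd).
    have d0 : d = 0 by case: hd; lia.
    by rewrite -[in add_index _ _]d0 add_index_single; apply: OnTrackEq.
  rewrite can_diagE; case: eqP => [xy|xy].
    apply: OnTrackIns => [|j hj]; last exact/hmin/ins_atS_r.
    case: (ins_atS hd) => [dk|[] //].
    (* If [d = k.+1], the prefixes agree, and with [X k = Y k.+1] the smaller index [k] would also
       be an insertion position, against minimality. *)
    have hk : agree X Y k.+1 by apply/ins_at_last; rewrite -{2}dk.
    suff /hmin : ins_at X Y k.+1 k by lia.
    apply/ins_atS_r => //; apply/ins_at_last; exact: agree_le hk _.
  case: (ins_atS hd) => [dk|[] //].
  rewrite dk in hd *; rewrite (_ : can_left _ _ _ = true).
    by rewrite /= -dk add_index_single; apply: OnTrackEq; rewrite dk; apply/ins_at_last.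
  by apply/(can_left_ins hd)/ins_at_last.
- case: ifP => [/(can_up_del he) h|/negP up]; first exact: OnTrackEq.
  have neq : ~ agree X Y k by move=> h; apply: up; apply/(can_up_del he).
  case: k he neq {up} => [|k] he neq; first by case: neq.
  have [xy he'] := del_diag he neq.
  by rewrite can_diagE xy eqxx; apply: OnTrackDel he'.
- have [-> ->] := can_eq h; case: k h => [|k] h; first exact: OnTrackEq.
  by have /agreeS[h' xy] := h; rewrite can_diagE xy eqxx; apply: OnTrackEq.
Qed.

(** Where a leftward move is possible from a state before both moves or between up and left, the
    last index of the current prefix of [y] is itself a candidate, so the maximum [d] equals it.
    Where it is impossible, [d] is smaller and survives the next move. *)
Lemma step2_on_track st : on_track x y d geq st ->
  on_track x y d geq (step2 x y (Hmx x y) st).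
Proof.
case=> [k kn neq hd hmax|k hd hmax|k e he|k h]; rewrite /step2.
- case: k kn neq hd hmax => [|k] kn neq hd hmax; first by case: neq.
  case: ifP => [/(can_left_diag neq hd)[e he]|/negP left].
    have -> : k.+1 = d.+1 by have /= := hmax _ (sub_at_del he); case: hd; lia.
    have dk : d = k by have /= := hmax _ (sub_at_del he); case: hd; lia.
    by rewrite dk in hmax hd *; rewrite add_index_single; apply: OnTrackDel he.
  rewrite can_diagE; case: eqP => [xy|xy].
    case: (ltnP d k) => dk; last first.
      case: left; apply/(can_left_diag neq hd).
      have dk' : d = k by case: (hd); lia.
      by apply: sub_at_last; rewrite -{2}dk'.
    apply: OnTrackFar => [||//|j hj]; first by lia.
    + by move=> h; apply: neq; apply/agreeS.
    + exact: sub_at_prefix.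
    + exact/hmax/sub_atS_r.
  case: (sub_atS hd) => [hi|[-> [e he]]|[_ //]].
    rewrite (_ : can_up _ _ _ = true); last by apply/(can_up_diag neq hd); exists d.
    by apply: OnTrackIns => // j /ins_at_sub/hmax.
  by case: left; apply/(can_left_diag neq hd); exists e.
- case: ifP => [/(can_left_ins hd) h|/negP left].
    have /hmax /= kd : ins_at X Y k k by apply/ins_at_last.
    have dk : d = k by case: hd; lia.
    by rewrite -dk add_index_single dk; apply: OnTrackEq.
  case: k hd hmax left => [|k] hd hmax left.
    by case: left; apply/(can_left_ins hd).
  case: (ins_atS hd) => [dk|[hd' xy]].
    by case: left; apply/(can_left_ins hd)/ins_at_last; rewrite -{2}dk.
  rewrite can_diagE xy eqxx; apply: OnTrackIns => // j hj.
  exact/hmax/ins_atS_r.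
- rewrite (can_left_del he); case: ifP => diag.
    case: k he diag => // k he; rewrite can_diagE => /eqP xy.
    case: (ins_atS he) => [ek|[he' _]]; last exact: OnTrackDel he'.
    (* The prefixes agree, yet the diagonal is preferred to the upward move; the index deleted from
       [x] drops from [k.+1] to [k]. *)
    apply: (@OnTrackDel _ _ _ _ _ _ _ k); apply/ins_at_last.
    have {}he : agree Y X k.+1 by apply/ins_at_last; rewrite -{2}ek.
    by move=> l lk; apply: he; lia.
  case: k he diag => [|k] he diag.
    rewrite (_ : can_up _ _ _ = true); first exact: OnTrackEq.
    by apply/(can_up_del he).
  case: (ins_atS he) => [ek|[_ xy]].
    have h : agree X Y k.+1.
      by move=> l lk; symmetry; move: l lk; apply/ins_at_last; rewrite -{2}ek.
    rewrite (_ : can_up _ _ _ = true); first exact: OnTrackEq.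
    by apply/(can_up_del he).
  by rewrite can_diagE xy eqxx in diag.
- have [-> ->] := can_eq h; case: k h => [|k] h; first exact: OnTrackEq.
  by have /agreeS[h' xy] := h; rewrite can_diagE xy eqxx; apply: OnTrackEq.
Qed.
End Subroutines.

(** * At most two candidates, from the first and last differences *)

Lemma bump_lt h l : l < h -> bump h l = l.
Proof. by move=> lh; rewrite /bump leqNgt lh. Qed.

Lemma bump_ge h l : h <= l -> bump h l = l.+1.
Proof. by rewrite /bump => ->. Qed.

Section AtMostTwo.

Variables (T : eqType) (x y : nat -> T) (n p r : nat).

Hypothesis adj1 : forall k, 0 < k < n -> x k.-1 <> x k.
Hypothesis adj2 : forall k, 1 < k < n -> x k.-2 <> x k.
Hypothesis xp : x p != y p.
Hypothesis xr : x r != y r.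
Hypothesis pr : p <= r < n.
Hypothesis eqp : forall l, l < p -> x l = y l.
Hypothesis eqr : forall l, r < l < n -> x l = y l.

(** Let [e] be the index deleted from [x]. Outside the interval between [e] and [j] the sequences
    agree, so it contains [p] and [r]; inside, one is a shift of the other. If [j] lay two or more
    beyond [r], or before [p], the shift and the agreement there would give equal adjacent symbols
    of [x]. *)
Lemma sub_at_cases j : sub_at x y n j ->
  (j = r \/ j = r.+1 /\ y r = x r.+1) /\ (p < r -> y p = x p.+1) \/
  (j = p \/ j.+1 = p /\ y p = x j) /\ (p < r -> y r = x r.-1).
Proof.
move=> [jn [e en h]]; have [ej|je] := leqP e j.
- left.
  have h1 l : l < e -> x l = y l.
    move=> le; have lj := leq_trans le ej.
    by have := h l; rewrite !bump_lt //; apply; lia.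
  have h2 l : e <= l < j -> y l = x l.+1.
    move=> /andP[el lj]; have := h l; rewrite (bump_ge el) (bump_lt lj) => -> //; lia.
  have h3 l : j < l < n -> x l = y l.
    case: l => // l /andP[jl ln]; have := h l.
    by rewrite !bump_ge //; [apply; lia | exact: leq_trans ej jl].
  have ep : e <= p by rewrite leqNgt; apply: contraNN xp => /h1 ->.
  have rj : r <= j.
    by rewrite leqNgt; apply: contraNN xr => rj; rewrite h3 //; lia.
  split=> [|pr']; last by apply: h2; lia.
  have [->|jr] := eqVneq j r; first by left.
  right; split; last by apply: h2; lia.
  apply/eqP; rewrite eqn_leq [in X in _ && X]ltn_neqAle eq_sym jr rj andbT leqNgt.
  apply/negP => rj'; apply: (adj1 (k := r.+2)); first by lia.
  by rewrite -h2 /= ?eqr //; lia.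
right.
have h1 l : l < j -> x l = y l.
  move=> lj; have le := ltn_trans lj je.
  by have := h l; rewrite !bump_lt //; apply; lia.
have h2 l : j <= l < e -> x l = y l.+1.
  move=> /andP[jl le]; have := h l; rewrite (bump_lt le) (bump_ge jl) => -> //; lia.
have h3 l : e < l < n -> x l = y l.
  case: l => // l /andP[el ln]; have := h l.
  by rewrite !bump_ge //; [apply; lia | exact: leq_trans (ltnW je) el].
have jp : j <= p by rewrite leqNgt; apply: contraNN xp => /h1 ->.
have re : r <= e.
  by rewrite leqNgt; apply: contraNN xr => re; rewrite h3 //; lia.
split=> [|pr']; last by rewrite h2 ?prednK //; lia.
have [->|jp'] := eqVneq j p; first by left.
suff jp2 : j.+1 = p by right; split=> //; rewrite h2 ?jp2 //; lia.
apply/eqP; rewrite eqn_leq ltn_neqAle jp' jp leqNgt /=.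
apply/negP => jp2; apply: (adj1 (k := j.+1)); first by lia.
by rewrite /= h2 ?eqp //; lia.
Qed.

(** Each of the two kinds in [sub_at_cases] allows two indices, so three indices mix the kinds and
    include [p.-1] or [r.+1]. Then [y p] equals both neighbours of [x p], or [y r] both neighbours
    of [x r], contradicting [adj2]. *)
Lemma sub_at_no_three j1 j2 j3 : j1 < j2 < j3 ->
  sub_at x y n j1 -> sub_at x y n j2 -> sub_at x y n j3 -> False.
Proof.
move=> lt h1 h2 h3; have [[? _] [? _] [? _]] := And3 h1 h2 h3.
have no_pred : y p = x p.-1 -> y p = x p.+1 -> 0 < p -> p.+1 < n -> False.
  by move=> e1 e2 p0 pn; apply: (adj2 (k := p.+1)); [lia | exact: etrans (esym e1) e2].
have no_succ : y r = x r.-1 -> y r = x r.+1 -> 0 < r -> r.+1 < n -> False.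
  by move=> e1 e2 r0 rn; apply: (adj2 (k := r.+1)); [lia | exact: etrans (esym e1) e2].
case: (sub_at_cases h1) (sub_at_cases h2) (sub_at_cases h3)
  => -[c1 d1] [] [c2 d2] [] [c3 d3]; try lia.
all: case: c1 c2 c3 => [c1|[c1 e1]] [c2|[c2 e2]] [c3|[c3 e3]]; try lia.
all: have [pr'|pr'] : p < r \/ p = r by lia.
all: try lia.
all: by subst; first [apply: no_pred; by [|auto|lia] | apply: no_succ; by [|auto|lia]].
Qed.

End AtMostTwo.

(** * Deletions in tuples, and what the hypotheses say about symbols *)

Lemma sorted_ord_eq n (s1 s2 : seq 'I_n) :
  sorted ltn (map val s1) -> sorted ltn (map val s2) -> s1 =i s2 -> s1 = s2.
Proof.
rewrite !sorted_map; apply: irr_sorted_eq => [i j k|i]; first exact: ltn_trans.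
exact: ltnn.
Qed.

Lemma enum_set_sorted n (A : {set 'I_n}) : sorted ltn (map val (enum A)).
Proof.
rewrite sorted_map /enum_mem -enumT; apply: sorted_filter => [i j k|].
  exact: ltn_trans.
by rewrite -(sorted_map (f := val)) val_enum_ord iota_ltn_sorted.
Qed.

Lemma enum_setC1 n (s : 'I_n.+1) : enum (~: [set s]) = map (lift s) (enum 'I_n).
Proof.
apply: sorted_ord_eq; first exact: enum_set_sorted.
  rewrite -map_comp (eq_map (g := bump s \o val)) // map_comp val_enum_ord.
  apply: (homo_sorted_in (P := predT) (e := ltn)) (iota_ltn_sorted _ _) => [i j _ _ /=|].
    by rewrite /bump; lia.
  exact: all_predT.
move=> i; rewrite mem_enum !inE; apply/idP/mapP => [|[k _ ->]].
  by case: (unliftP s i) => [k ->|->]; [exists k; rewrite ?mem_enum | rewrite eqxx].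
by rewrite eq_sym neq_lift.
Qed.

Lemma onth_tuple (T : Type) n (x : n.-tuple T) (i : 'I_n) :
  onth x i = Some (tnth x i).
Proof. by apply/tnth_onth. Qed.

Lemma onth_del1 (T : Type) n (s : 'I_n) (x : n.-tuple T) l :
  onth (del [set s] x) l = onth x (bump s l).
Proof.
case: n s x => [|n] s x; first by case: s.
rewrite /del enum_setC1 -map_comp onth_map.
(* The tuple has length [n.+1]. For [n <= l] both sides are [None], since [s <= l] gives
   [bump s l = l.+1]. *)
have [ln|nl] := ltnP l n; last first.
  rewrite !onth_default ?size_tuple -?cardE ?card_ord //.
  by rewrite /bump; have := ltn_ord s; lia.
have -> : onth (enum 'I_n) l = Some (Ordinal ln).
  by rewrite onthE (nth_map (Ordinal ln)) -?cardE ?card_ord // (nth_ord_enum _ (Ordinal ln)).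
by rewrite /= -onth_tuple.
Qed.

Lemma size_del1 (T : Type) n (s : 'I_n) (x : n.-tuple T) :
  size (del [set s] x) = n.-1.
Proof. by rewrite size_map -cardE cardsC1 card_ord. Qed.

Lemma del1_eqP (T : eqType) n (x y : n.-tuple T) (i j : 'I_n) :
  del [set i] x = del [set j] y <->
  forall l, l < n.-1 -> onth x (bump i l) = onth y (bump j l).
Proof.
split=> [e l _|h]; first by rewrite -!onth_del1 e.
apply: eq_from_onth_le => l; rewrite !size_del1 maxnn => /h.
by rewrite !onth_del1.
Qed.

Lemma mem_D1 q n (x y : n.-tuple 'I_q) (j : 'I_n) :
  (del [set j] y \in D1 x) <-> sub_at (onth x) (onth y) n j.
Proof.
split=> [/mapP[i _ /esym/del1_eqP h]|[_ [e en h]]].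
  by split; [exact: ltn_ord | exists (val i); [exact: ltn_ord | exact: h]].
apply/mapP; exists (Ordinal en); first by rewrite mem_enum.
by symmetry; apply/del1_eqP.
Qed.

Lemma agree_eq (T : eqType) n (x y : n.-tuple T) :
  agree (onth x) (onth y) n -> x = y.
Proof.
move=> h; apply/val_inj/eq_from_onth_le => l.
by rewrite !size_tuple maxnn => /h.
Qed.

(** Both [x] and [y] come from [z] by deleting one position, [s'] and [s], distinct because [y]
    differs from [x]. Deleting both gives a common sequence, and [unbump] renumbers the other
    position after the first deletion. *)
Lemma L1_sub_at q n (x y : n.-tuple 'I_q) : y \in L1 x ->
  exists j, sub_at (onth x) (onth y) n j.
Proof.
rewrite !inE => /andP[yx /existsP[s /existsP[s' /existsP[lam /eqP e]]]].
pose z := ins s' lam x.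
have xE l : l < n -> onth x l = onth z (bump s' l).
  move=> ln; have := onth_tuple z (lift s' (Ordinal ln)).
  by rewrite tnth_mktuple liftK -onth_tuple => ->.
have yE l : onth y l = onth z (bump s l) by rewrite -e onth_del1.
have ss' : s != s' :> nat.
  apply: contraNneq yx => ss'; apply/eqP/esym/agree_eq => l ln.
  by rewrite xE // yE ss'.
have sn := ltn_ord s; have sn' := ltn_ord s'.
exists (unbump s s'); split; first by rewrite /unbump; lia.
exists (unbump s' s); first by rewrite /unbump; lia.
move=> l ln; rewrite xE ?yE; last by rewrite /bump /unbump; lia.
by congr onth; rewrite /bump /unbump; lia.
Qed.

(** Nothing from [a] up to [b] is kept before [b], so replacing the kept [b] by [a] preserves both
    the order and the symbols. *)
Lemma del_exchange (T : Type) n (x : n.-tuple T) (S : {set 'I_n}) (a b : 'I_n) :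
  a < b -> tnth x a = tnth x b -> b \notin S ->
  (forall i : 'I_n, a <= i < b -> i \in S) ->
  del (b |: S :\ a) x = del S x.
Proof.
move=> ab xab bS hS.
pose f i := if i == b then a else i.
rewrite /del; have -> : enum (~: (b |: S :\ a)) = map f (enum (~: S)).
  apply: sorted_ord_eq; first exact: enum_set_sorted.
    have := enum_set_sorted (~: S); rewrite sorted_map => sS; rewrite sorted_map.
    apply: (homo_sorted_in (P := mem (~: S))) sS => [i j|]; last first.
      by apply/allP => i; rewrite mem_enum.
    rewrite /= !inE /f => iS jS ij.
    have [ib|_] := eqVneq i b; have [jb|_] := eqVneq j b => //.
    - by rewrite ib jb ltnn in ij.
    - by rewrite ib in ij; exact: ltn_trans ab ij.
    - by rewrite ltnNge; apply: contraNN iS => ai; apply: hS; rewrite ai -jb.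
  move=> i; rewrite mem_enum !inE; apply/idP/mapP => [|[k]]; last first.
    rewrite mem_enum inE /f => kS ->.
    have [_|kb] := eqVneq k b; first by rewrite eqxx orbF -val_eqE neq_ltn ab.
    by rewrite (negPf kb) (negPf kS) andbF.
  rewrite negb_or negb_and negbK => /andP[ib] /orP[/eqP ->|iS].
    by exists b; rewrite ?mem_enum ?inE // /f eqxx.
  by exists i; rewrite ?mem_enum ?inE // /f (negPf ib).
rewrite -map_comp; apply: eq_map => i /=.
by rewrite /f; case: eqP => // ->.
Qed.

Lemma exists_set_between (I : finType) (A B : {set I}) t :
  A \subset B -> #|A| <= t <= #|B| ->
  exists S : {set I}, [/\ A \subset S, S \subset B & #|S| = t].
Proof.
move=> AB /andP[At tB]; have : t - #|A| <= #|B :\: A| by rewrite cardsDS //; lia.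
move=> /card_geqP[s [us ss sB]]; exists (A :|: [set i in s]); split.
- exact: subsetUl.
- rewrite subUset AB; apply/subsetP => i; rewrite inE => /sB.
  by rewrite inE => /andP[].
rewrite cardsU cardsE (card_uniqP us) ss (_ : A :&: _ = set0) ?cards0; first by lia.
by apply/setP => i; rewrite !inE; apply/negP => /andP[iA /sB]; rewrite inE iA.
Qed.

(** With equal symbols, a set [S] of size [t] containing all of [a, ..., b - 1] but not [b] could
    exchange [a] for [b]. Such an [S] exists because [b - a <= t <= n - 1]. *)
Lemma E_distinct n q t (x : n.-tuple 'I_q) (a b : 'I_n) :
  x \in E n q t -> t < n -> a < b -> b - a <= t -> tnth x a <> tnth x b.
Proof.
move=> xE tn ab bat xab.
pose A := [set i : 'I_n | a <= i < b].
have cA : #|A| <= t.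
  apply: leq_trans bat.
  rewrite -(size_iota a (b - a)) cardE -(size_map val).
  apply: uniq_leq_size; first by rewrite (map_inj_uniq val_inj) enum_uniq.
  by move=> _ /mapP[i + ->]; rewrite mem_enum inE mem_iota /= => ?; lia.
have [||S [AS SB cS]] := @exists_set_between _ A (~: [set b]) t.
- by apply/subsetP => i; rewrite !inE -val_eqE /=; lia.
- by rewrite cA cardsC1 card_ord /=; lia.
have bS : b \notin S by apply/negP => /(subsetP SB); rewrite !inE eqxx.
have hS (i : 'I_n) : a <= i < b -> i \in S.
  by move=> h; apply: (subsetP AS); rewrite inE.
have aS : a \in S by apply: hS; rewrite leqnn.
move: xE; rewrite inE => /forallP/(_ S)/forallP/(_ (b |: S :\ a)).
rewrite (del_exchange ab xab bS hS) eqxx cS eqxx cardsU1 !inE (negPf bS) andbF /=.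
have := cardsD1 a S; rewrite aS cS => <-; rewrite eqxx /= => /eqP e.
by move: bS; rewrite e setU11.
Qed.

(** * Outputs of the subroutines and conclusion *)

Lemma on_track_end (T : eqType) n (x y : n.-tuple T) d le st :
  on_track x y d le st -> st.1 = (0, 0) -> st.2 = single n d.
Proof. by case=> [k _ neq _ _|k _ _|k e _|k _] //= -[k0]; case: neq; rewrite k0. Qed.

Lemma subroutine1_min (T : eqType) n (x y : n.-tuple T) (d : 'I_n) :
  (forall k, 1 < k < n -> onth x k.-1 <> onth x k) -> x <> y ->
  sub_at (onth x) (onth y) n d ->
  (forall j, sub_at (onth x) (onth y) n j -> d <= j) ->
  subroutine1 x y (Hmx x y) = [set d].
Proof.
move=> adj xy hd hmin.
have -> : [set d] = single n d by apply/setP => k; rewrite !inE -val_eqE.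
apply: (on_track_end (le := leq)) (run1_halts x y).
apply: (iter_invariant (P := on_track x y d leq)) => [st|].
  exact: step1_on_track.
by apply: OnTrackFar => // /agree_eq.
Qed.

Lemma subroutine2_max (T : eqType) n (x y : n.-tuple T) (d : 'I_n) :
  x <> y -> sub_at (onth x) (onth y) n d ->
  (forall j, sub_at (onth x) (onth y) n j -> j <= d) ->
  subroutine2 x y (Hmx x y) = [set d].
Proof.
move=> xy hd hmax.
have -> : [set d] = single n d by apply/setP => k; rewrite !inE -val_eqE.
apply: (on_track_end (le := geq)) (run2_halts x y).
apply: (iter_invariant (P := on_track x y d geq)) => [st|].
  exact: step2_on_track.
by apply: OnTrackFar => // /agree_eq.
Qed.

Lemma first_last_diff (T : eqType) (x y : nat -> T) n : ~ agree x y n ->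
  exists p r, [/\ x p != y p, x r != y r, p <= r < n,
    forall l, l < p -> x l = y l & forall l, r < l < n -> x l = y l].
Proof.
move=> neq; pose P l := (l < n) && (x l != y l).
have exP : exists l, P l.
  have [/existsP[i hi]|] := boolP [exists i : 'I_n, x i != y i].
    by exists i; rewrite /P ltn_ord.
  rewrite negb_exists => /forallP h; case: neq => l ln.
  by apply/eqP; rewrite -[_ == _]negbK (h (Ordinal ln)).
have bP l : P l -> l <= n by case/andP => /ltnW.
case: (ex_minnP exP) => p /andP[pn xp] minp.
case: (ex_maxnP exP bP) => r /andP[rn xr] maxr.
exists p, r; split=> // [|l lp|l /andP[rl ln]].
- by rewrite rn minp // /P rn.
- apply/eqP/negPn/negP => xl.
  by have := minp l; rewrite /P xl (ltn_trans lp pn) leqNgt lp => /(_ isT).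
- apply/eqP/negPn/negP => xl.
  by have := maxr l; rewrite /P xl ln leqNgt rl => /(_ isT).
Qed.

(* For t >= n there is at most one S with #|S| = t, so x \in E n q t holds for
   every x, and the conclusion fails for all such t as soon as n >= 3 and
   q >= 2; this is what htn excludes. *)
Theorem theorem4 (n q t : nat) (hn : 0 < n) (hq : 0 < q) (ht : 0 < t)
    (htn : 2 < n -> t < n)
    (x y : n.-tuple 'I_q) (hx : x \in E n q t) (hy : y \in L1 x)
    (ht2 : 2 <= t) :
  let J := [set j : 'I_n | del [set j] y \in D1 x] in
  let S1 := subroutine1 x y (Hmx x y) in
  let S2 := subroutine2 x y (Hmx x y) in
  J = S1 :|: S2 /\ #|S1 :|: S2| <= 2.
Proof.
move=> J S1 S2.
have distinct k l : 2 < n -> k < l < n -> l - k <= 2 -> onth x k <> onth x l.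
  move=> n2 /andP[kl ln] lk; have kn := ltn_trans kl ln.
  rewrite (onth_tuple x (Ordinal kn)) (onth_tuple x (Ordinal ln)) => -[].
  exact: (@E_distinct _ _ _ _ (Ordinal kn) (Ordinal ln) hx (htn n2) kl (leq_trans lk ht2)).
have xy : x <> y by move=> xy; move: hy; rewrite !inE xy eqxx.
have [j hj] := L1_sub_at hy; have jn : j < n by case: hj.
have inJ (i : 'I_n) : i \in J <-> sub_at (onth x) (onth y) n i.
  by rewrite inE; exact: mem_D1.
have j0J : Ordinal jn \in J by apply/inJ.
case: (arg_minnP (fun i : 'I_n => val i) j0J) => a aJ amin.
case: (arg_maxnP (fun i : 'I_n => val i) j0J) => b bJ bmax.
have hmin i : sub_at (onth x) (onth y) n i -> a <= i.
  by move=> hi; have ltin : i < n := proj1 hi; apply: (amin (Ordinal ltin)); apply/inJ.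
have hmax i : sub_at (onth x) (onth y) n i -> i <= b.
  by move=> hi; have ltin : i < n := proj1 hi; apply: (bmax (Ordinal ltin)); apply/inJ.
have -> : S1 = [set a].
  (* The range [1 < k < n] already forces [2 < n], so [distinct] applies. *)
  apply: subroutine1_min => // [k /andP[k1 kn]|]; last exact/inJ.
  by apply: distinct; lia.
have -> : S2 = [set b] by apply: subroutine2_max => //; exact/inJ.
split; last by rewrite cards2; case: (a != b).
apply/setP => c; rewrite in_set2; apply/idP/orP => [cJ|[/eqP->|/eqP->]] //.
have [_|ca] := eqVneq c a; first by left.
have [_|cb] := eqVneq c b; first by right.
(* A third element of [J] would lie strictly between the extremes. *)
have acb : a < c < b.
  have /inJ hc := cJ; have := hmin _ hc; have := hmax _ hc.
  by move: ca cb; rewrite -!val_eqE /=; lia.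
have n2 : 2 < n by have := ltn_ord b; lia.
have [|p [r [xp xr pr eqp eqr]]] := @first_last_diff _ (onth x) (onth y) n.
  by move/agree_eq.
exfalso; apply: (sub_at_no_three _ _ xp xr pr eqp eqr acb); try exact/inJ.
- by case=> // k /andP[_ kn]; apply: distinct => //; rewrite ?kn ?andbT ?subSnn.
- case=> [|[|k]] // /andP[_ kn]; apply: distinct => //=.
    by rewrite kn andbT.
  by rewrite -addn2 addKn.
Qed.
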